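(* For $a\in\mathbb{D}$, $$N(C_a-I)=\{f\in\mathcal{H}: C_{\omega_a}f\in\mathcal{E}\}=C_{\omega_a}\mathcal{E}$$ and $$N(C_a+I)=\{g\in\mathcal{H}: C_{\omega_a}g\in\mathcal{O}\}=C_{\omega_a}\mathcal{O}.$$
   Context: $\mathbb{D}=\{z\in\mathbb{C}:|z|<1\}$, $\mathbb{T}=\{z\in\mathbb{C}:|z|=1\}$, and $\mathcal{H}=L^2(\mathbb{T})$ with respect to normalized Lebesgue measure. For $a\in\mathbb{D}$, $\varphi_a(z)=\frac{a-z}{1-\bar a z}$ and $C_a:\mathcal{H}\to\mathcal{H}$ is the bounded composition operator $C_af=f\circ\varphi_a$ (so $C_a^2=I$). $\omega_a$ is the unique fixed point of $\varphi_a$ in $\mathbb{D}$: $\omega_a=\frac{1}{\bar a}\left(1-\sqrt{1-|a|^2}\right)$ if $a\neq 0$, and $\omega_0=0$. $\mathcal{E}\subset\mathcal{H}$ is the closed subspace of even elements ($f(-z)=f(z)$ a.e. in $\mathbb{T}$) and $\mathcal{O}\subset\mathcal{H}$ the closed subspace of odd elements ($f(-z)=-f(z)$ a.e.). $N(T)$ denotes the nullspace of $T$. *)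

(* Defs.v *)
From HB Require Import structures.
From mathcomp Require Import all_boot all_order all_algebra.
From mathcomp Require Import ring lra.
From mathcomp Require Import complex.
From mathcomp Require Import all_classical all_reals all_analysis.
From mathcomp Require Import measurable_realfun.

Set Implicit Arguments.
Unset Strict Implicit.
Unset Printing Implicit Defensive.

Import Order.TTheory GRing.Theory Num.Theory.
Import numFieldNormedType.Exports.
Import ComplexField Normc.

Local Open Scope classical_set_scope.
Local Open Scope ring_scope.
Local Open Scope complex_scope.

Local Notation Re := complex.Re.
Local Notation Im := complex.Im.

(** * The Borel sigma-algebra of the complex plane *)

Section complex_measurable.
Variable R : realType.

HB.instance Definition _ := isPointed.Build R[i] 0.

Definition complex_pair (z : R[i]) : R * R := (Re z, Im z).

(* The Borel sigma-algebra of C, transported from R * R. *)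
HB.instance Definition _ :=
  Measurable.copy R[i] (g_sigma_algebra_preimageType complex_pair).

Lemma measurable_complexP d (T : measurableType d) (f : T -> R[i]) :
  measurable_fun setT f <->
  measurable_fun setT (fun x => Re (f x)) /\
  measurable_fun setT (fun x => Im (f x)).
Proof.
split=> [mf|[mr mi]].
  have mp : measurable_fun setT (complex_pair \o f).
    move=> _ A mA; rewrite setTI comp_preimage -[X in measurable X]setTI.
    by apply: mf => //; exists A => //; rewrite setTI.
  by split; [exact: (measurableT_comp measurable_fst mp)
            |exact: (measurableT_comp measurable_snd mp)].
move=> _ _ [A mA <-]; rewrite !setTI -comp_preimage -[X in measurable X]setTI.
exact: (measurable_fun_pair mr mi).
Qed.

Lemma measurable_addc d (T : measurableType d) (f g : T -> R[i]) :
  measurable_fun setT f -> measurable_fun setT g ->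
  measurable_fun setT (fun x => f x + g x).
Proof.
move=> /measurable_complexP[fr fi] /measurable_complexP[gr gi].
apply/measurable_complexP; split.
  by under eq_fun do rewrite raddfD/=; exact: measurable_funD.
by under eq_fun do rewrite raddfD/=; exact: measurable_funD.
Qed.

Lemma measurable_mulc d (T : measurableType d) (f g : T -> R[i]) :
  measurable_fun setT f -> measurable_fun setT g ->
  measurable_fun setT (fun x => f x * g x).
Proof.
move=> /measurable_complexP[fr fi] /measurable_complexP[gr gi].
have reM (z w : R[i]) : Re (z * w) = Re z * Re w - Im z * Im w.
  by case: z w => [a b] [c e].
have imM (z w : R[i]) : Im (z * w) = Re z * Im w + Im z * Re w.
  by case: z w => [a b] [c e].
apply/measurable_complexP; split.
  under eq_fun do rewrite reM.
  by apply: measurable_funB; exact: measurable_funM.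
under eq_fun do rewrite imM.
by apply: measurable_funD; exact: measurable_funM.
Qed.

Lemma normc_ge0 (z : R[i]) : 0 <= normc z.
Proof. by case: z => a b; rewrite /= sqrtr_ge0. Qed.

Lemma normc_sqr (z : R[i]) : normc z ^+ 2 = Re z ^+ 2 + Im z ^+ 2.
Proof. by case: z => a b; rewrite /= sqr_sqrtr// addr_ge0// sqr_ge0. Qed.

Lemma measurable_normc_sqr d (T : measurableType d) (f : T -> R[i]) :
  measurable_fun setT f -> measurable_fun setT (fun x => normc (f x) ^+ 2).
Proof.
move=> /measurable_complexP[fr fi]; under eq_fun do rewrite normc_sqr.
by apply: measurable_funD; exact: measurable_funX.
Qed.

Lemma measurable_invc d (T : measurableType d) (f : T -> R[i]) :
  (forall x, f x != 0) -> measurable_fun setT f ->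
  measurable_fun setT (fun x => (f x)^-1).
Proof.
move=> f0 mf; move: (mf) => /measurable_complexP[fr fi].
have n0 x : 0 < normc (f x) ^+ 2.
  rewrite exprn_gt0// lt_neqAle; apply/andP; split.
    by apply: contra (f0 x); rewrite eq_sym => /eqP/eq0_normc ->.
  exact: normc_ge0.
have nE (z : R[i]) : 0 < normc z ^+ 2 ->
    z^-1 = (Re z * expR (- ln (normc z ^+ 2)))
         -i* (Im z * expR (- ln (normc z ^+ 2))).
  by move=> z0; rewrite expRN lnK ?posrE// normc_sqr; case: z {z0}.
under eq_fun do rewrite nE//.
have me : measurable_fun setT (fun x => expR (- ln (normc (f x) ^+ 2))).
  apply: measurableT_comp => //; apply: measurableT_comp => //.
  by apply: measurableT_comp => //; exact: measurable_normc_sqr.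
apply/measurable_complexP; split => /=; first exact: measurable_funM.
by apply: measurableT_comp => //; exact: measurable_funM.
Qed.

End complex_measurable.

(** * The unit circle and its normalized Lebesgue measure *)

Definition circle (R : realType) := {z : R[i] | `|z| == 1}.

Section circle.
Variable R : realType.

HB.instance Definition _ := SubChoice.on (circle R).

Definition circle1 : circle R :=
  exist (fun z : R[i] => `|z| == 1) 1 (introT eqP (normr1 _)).

HB.instance Definition _ := isPointed.Build (circle R) circle1.

Definition circle_val (z : circle R) : R[i] := val z.

HB.instance Definition _ :=
  Measurable.copy (circle R) (g_sigma_algebra_preimageType circle_val).

Lemma circle_norm (z : circle R) : `|circle_val z| = 1.
Proof. exact/eqP/(valP z). Qed.

Lemma measurable_circle_val : measurable_fun setT circle_val.
Proof. by move=> _ A mA; exists A. Qed.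

Lemma measurable_circleP d (T : measurableType d) (f : T -> circle R) :
  measurable_fun setT (fun x => circle_val (f x)) -> measurable_fun setT f.
Proof.
move=> mf _ _ [A mA <-]; rewrite !setTI -comp_preimage.
by rewrite -[X in measurable X]setTI; exact: mf.
Qed.

Lemma circle_opp_subproof (z : circle R) : `|- val z| == 1.
Proof. by rewrite normrN (valP z). Qed.

Definition circle_opp (z : circle R) : circle R :=
  exist (fun w : R[i] => `|w| == 1) (- val z) (circle_opp_subproof z).

Lemma expi_subproof (t : R) : `|cos t +i* sin t| == 1.
Proof. by rewrite normc_def /= cos2Dsin2 sqrtr1. Qed.

Definition expi (t : measurableTypeR R) : circle R :=
  exist (fun z : R[i] => `|z| == 1) (cos (t : R) +i* sin (t : R)) (expi_subproof t).

Lemma measurable_expi : measurable_fun setT expi.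
Proof.
apply/measurable_circleP/measurable_complexP; split => /=.
  by apply: continuous_measurable_fun; exact: continuous_cos.
by apply: continuous_measurable_fun; exact: continuous_sin.
Qed.

Lemma pi2_gt0 : 0 < pi *+ 2 :> R.
Proof. by rewrite pmulrn_lgt0// pi_gt0. Qed.

HB.instance Definition _ :=
  isMeasurableFun.Build _ _ (measurableTypeR R) (circle R) expi measurable_expi.

(* Image under t |-> exp(i t) of the uniform probability on [0, 2 pi]. *)
Definition circle_measure : set (circle R) -> \bar R :=
  distribution (uniform_prob pi2_gt0) expi.

HB.instance Definition _ := Probability.on circle_measure.

End circle.

Arguments circle_measure : clear implicits.
Arguments pi2_gt0 : clear implicits.

Section circle_measure_theory.
Variable R : realType.
Implicit Types (s t : R) (z w : circle R).

Lemma uniform_prob2pi (B : set R) : measurable B ->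
  uniform_prob (pi2_gt0 R) B =
  ((pi *+ 2)^-1%:E * lebesgue_measure (B `&` `[0%R, (pi *+ 2)%R]))%E.
Proof.
move=> mB; rewrite /uniform_prob integral_uniform_pdf.
rewrite (eq_integral (fun=> (pi *+ 2)^-1%:E)); last first.
  move=> x; rewrite inE => -[_] /=; rewrite in_itv/= /uniform_pdf => ->.
  by rewrite subr0.
by rewrite integral_cst//; exact: measurableI.
Qed.

Lemma chordE s t :
  normc (circle_val (expi s) - circle_val (expi t)) = 2 * `|sin ((s - t) / 2)|.
Proof.
apply/eqP; rewrite -(@eqrXn2 _ 2)//; last exact: normc_ge0.
rewrite normc_sqr /= exprMn real_normK ?num_real//.
have [sE tE] : s = (s + t) / 2 + (s - t) / 2 /\ t = (s + t) / 2 - (s - t) / 2.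
  by split; field.
move: ((s + t) / 2) ((s - t) / 2) sE tE => u v -> ->.
rewrite cosD sinD cosB sinB.
have := cos2Dsin2 u; move: (cos u) (sin u) (cos v) (sin v) => a b c d ab.
have -> : 2 ^+ 2 * d ^+ 2 = 2 ^+ 2 * d ^+ 2 * (a ^+ 2 + b ^+ 2).
  by rewrite ab mulr1.
by apply/eqP; ring.
Qed.

Lemma sin_MVT t : 0 <= t -> exists2 c : R, c \in `[0, t] & sin t = cos c * t.
Proof.
have scont : {within `[0, t], continuous (@sin R)}.
  by apply: continuous_subspaceT; exact: continuous_sin.
move=> t0; have [c c0t] := MVT_segment t0 (fun x _ => is_derive_sin x) scont.
by rewrite sin0 !subr0 => st; exists c.
Qed.

Lemma sin_le_norm t : `|sin t| <= `|t|.
Proof.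
wlog t0 : t / 0 <= t.
  move=> h; have [/h//|/ltW t0] := leP 0 t.
  by have := h (- t); rewrite sinN !normrN oppr_ge0; exact.
have [c _ ->] := sin_MVT t0.
by rewrite normrM ler_piMl// ler_norml cos_geN1 cos_le1.
Qed.

Lemma sin_ge_half t : 0 <= t <= pi / 2 -> t / 2 <= sin t.
Proof.
move=> /andP[t0 tpi]; have t20 : 0 <= t / 2 by rewrite divr_ge0.
have cos_ge (x : R) : 0 <= x <= pi / 4 -> cos (pi / 4) <= cos x.
  move=> /andP[x0 xpi]; rewrite leNgt; apply/negP => xlt.
  have p0 := pi_gt0 R.
  have xin : x \in `[0, pi] by rewrite in_itv/= x0/=; lra.
  have pin : pi / 4 \in `[0, pi : R] by rewrite in_itv/=; lra.
  by move: xlt; rewrite ltr_cos// ltNge xpi.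
have cpi : cos (pi / 4 : R) ^+ 2 = 2^-1.
  have := cos_mulr2n (pi / 4 : R).
  have -> : (pi / 4 : R) *+ 2 = pi / 2 by rewrite -mulr_natr; field.
  by rewrite cos_pihalf => h; lra.
have [c] := sin_MVT t20; rewrite in_itv/= => /andP[c0 ct] sE.
have -> : t = (t / 2) *+ 2 by rewrite -mulr_natr; field.
rewrite sin_mulr2n sE.
have c1 : cos (pi / 4) <= cos c by apply: cos_ge; rewrite c0/=; lra.
have c2 : cos (pi / 4) <= cos (t / 2) by apply: cos_ge; rewrite t20/=; lra.
have cpi0 : 0 <= cos (pi / 4 : R).
  by apply: cos_ge0_pihalf; have := pi_gt0 R; lra.
have : cos (pi / 4 : R) ^+ 2 <= cos (t / 2) * cos c.
  by rewrite expr2 ler_pM.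
rewrite cpi => h.
have : t / 2 * 2^-1 <= t / 2 * (cos (t / 2) * cos c) by rewrite ler_wpM2l.
by move: h => _ h; rewrite mulr2n [leRHS]mulr2n; lra.
Qed.

Lemma expi_surj z : exists2 t : R, 0 <= t <= pi *+ 2 & expi t = z.
Proof.
have := circle_norm z; case zE : (circle_val z) => [x y].
rewrite normc_def/= => -[/(congr1 (fun r => r ^+ 2))].
rewrite sqr_sqrtr ?addr_ge0 ?sqr_ge0// expr1n => xy.
have x1 : -1 <= x <= 1.
  by rewrite -ler_norml -[leRHS]sqrtr1 -sqrtr_sqr ler_sqrt// -xy lerDl sqr_ge0.
have [/andP[a0 api] ca] := acos_def x1.
have sa : sin (acos x) = `|y|.
  by rewrite sin_acos// -xy addrAC subrr add0r sqrtr_sqr.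
have p0 := pi_gt0 R.
have [y0|y0] := leP 0 y.
  exists (acos x); first by rewrite a0 mulr2n /=; lra.
  by apply/val_inj => /=; rewrite -[RHS]/(circle_val z) zE ca sa ger0_norm.
exists (pi *+ 2 - acos x); first by rewrite !mulr2n; apply/andP; split; lra.
apply/val_inj => /=; rewrite -[RHS]/(circle_val z) zE.
by rewrite cosB sinB cos2pi sin2pi ca sa ltr0_norm//; congr Complex; ring.
Qed.

End circle_measure_theory.

Section circle_nonsingular.
Variable R : realType.
Variables (g : circle R -> circle R) (K : R).
Hypothesis K0 : 0 <= K.
Hypothesis mg : measurable_fun setT g.
Hypothesis gK : forall z w : circle R,
  normc (circle_val z - circle_val w) <=
  K * normc (circle_val (g z) - circle_val (g w)).

Local Notation lambda := (@lebesgue_measure R).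
Local Notation lambda_ext := (mu_ext (wlength (@idfun R))).

Let pull (X : set R) : set R :=
  [set t | 0 <= t <= pi *+ 2 /\ exists2 s, X s & expi s = g (expi t)].

Let pull_dist a b t t' : pull `]a, b]%classic t -> pull `]a, b]%classic t' ->
  `|t - t'| <= pi -> `|t - t'| <= 2 * K * (b - a).
Proof.
move=> [tpi [s sab sE]] [tpi' [s' sab' sE']] tt'.
have up : normc (circle_val (expi t) - circle_val (expi t')) <= K * (b - a).
  apply: (le_trans (gK _ _)); rewrite -sE -sE' chordE ler_wpM2l//.
  apply: (@le_trans _ _ `|s - s'|).
    have := sin_le_norm ((s - s') / 2).
    by rewrite [X in _ <= X -> _]normrM (@ger0_norm _ 2^-1)//; lra.
  move: sab sab'; rewrite /= !in_itv/= => /andP[? ?] /andP[? ?].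
  by rewrite ler_norml; apply/andP; split; lra.
have lo : `|t - t'| / 2 <= normc (circle_val (expi t) - circle_val (expi t')).
  rewrite chordE.
  have h : 0 <= `|t - t'| / 2 <= pi / 2 by rewrite divr_ge0//= ler_pM2r.
  have := sin_ge_half h.
  have -> : `|sin ((t - t') / 2)| = `|sin (`|t - t'| / 2)|.
    have [_|_] := ger0P (t - t'); first by [].
    by rewrite mulNr sinN normrN.
  by have := ler_norm (sin (`|t - t'| / 2)); lra.
by lra.
Qed.

Let lambda_ext_ball (S : set R) (d : R) : 0 <= d ->
  (forall t t', S t -> S t' -> `|t - t'| <= d) -> (lambda_ext S <= (2 * d)%:E)%E.
Proof.
move=> d0 Sd; have [->|/set0P[t St]] := eqVneq S set0.
  by rewrite (@mu_ext0 _ _ _ (wlength idfun))// lee_fin mulr_ge0.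
apply: (@le_trans _ _ (lambda_ext `[t - d, t + d]%classic)).
  apply: le_mu_ext => t' St'; rewrite /= in_itv/=.
  by have := Sd _ _ St St'; rewrite ler_norml => /andP[? ?]; apply/andP; split; lra.
have -> : lambda_ext `[t - d, t + d]%classic = lambda `[t - d, t + d]%classic.
  by [].
rewrite lebesgue_measure_itv/=; case: ifPn => _; last by rewrite lee_fin mulr_ge0.
by rewrite -EFinD lee_fin; lra.
Qed.

Let pull_itv (X : set R) : ocitv X ->
  (lambda_ext (pull X) <= (8 * K)%:E * wlength (@idfun R) X)%E.
Proof.
move=> [[a b] _ <-] /=; have [ab|ba] := ltP a b; last first.
  rewrite set_itv_ge ?bnd_simp -?leNgt// wlength0 mule0.
  rewrite (_ : pull set0 = set0); last first.
    by rewrite -subset0 => t [_ [s []]].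
  by rewrite (@mu_ext0 _ _ _ (wlength idfun)).
rewrite wlength_itv/= lte_fin ab -EFinD -EFinM.
set S := pull _.
have d0 : 0 <= 2 * K * (b - a) by rewrite !mulr_ge0// subr_ge0 ltW.
have -> : S = (S `&` [set t | t <= pi]) `|` (S `&` [set t | pi <= t]).
  rewrite -setIUr; apply/esym/setIidPl => t _ /=.
  by have [|/ltW] := leP t pi; [left|right].
apply: (le_trans (outer_measureU2 lambda_ext _ _)).
have -> : (8 * K * (b - a))%:E =
    ((2 * (2 * K * (b - a)))%:E + (2 * (2 * K * (b - a)))%:E)%E.
  by rewrite -EFinD; congr EFin; ring.
apply: leeD; apply: lambda_ext_ball => // t t' [St tpi] [St' tpi'].
  apply: pull_dist => //; move: St St' tpi tpi' => [/andP[? ?] _] [/andP[? ?] _].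
  by rewrite /= => ? ?; rewrite ler_norml; apply/andP; split; lra.
apply: pull_dist => //; move: St St' tpi tpi' => [/andP[? ?] _] [/andP[? ?] _].
by rewrite /= => ? ?; rewrite ler_norml; apply/andP; split; lra.
Qed.

Let lambda_ext_pull (X : set R) :
  (lambda_ext (pull X) <= (8 * K + 1)%:E * lambda_ext X)%E.
Proof.
have K1 : 0 < 8 * K + 1 by rewrite ltr_wpDl ?mulr_ge0.
rewrite -lee_pdivrMl//; apply: le_ereal_inf_tmp => _ [F [mF XF] <-].
rewrite lee_pdivrMl//.
apply: (@le_trans _ _ (lambda_ext (\bigcup_k pull (F k)))).
  apply: le_mu_ext => t [tpi [s /XF[k _ Fks] sE]].
  by exists k => //; split => //; exists s.
apply: (le_trans (@outer_measure_sigma_subadditive _ _ lambda_ext _)).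
rewrite -nneseriesZl => [|i _]; last exact: measure_ge0.
apply: lee_nneseries => [k _ _|k _]; first exact: outer_measure_ge0.
apply: (le_trans (pull_itv (mF k))); rewrite lee_wpmul2r ?measure_ge0//.
by rewrite lee_fin lerDl.
Qed.

Lemma circle_measure_preimage : exists2 M : R, 0 <= M &
  forall A : set (circle R), measurable A ->
  (circle_measure R (g @^-1` A) <= M%:E * circle_measure R A)%E.
Proof.
exists (8 * K + 1); first by rewrite addr_ge0// mulr_ge0.
move=> A mA.
have me (B : set (circle R)) : measurable B -> measurable (@expi R @^-1` B).
  by move=> mB; rewrite -[X in measurable X]setTI; exact: measurable_expi.
have mgA : measurable (g @^-1` A) by rewrite -[X in measurable X]setTI; exact: mg.
have mE (B : set (circle R)) : measurable B -> circle_measure R B =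
    ((pi *+ 2)^-1%:E *
     lebesgue_measure ((@expi R @^-1` B) `&` `[0%R, (pi *+ 2)%R]))%E.
  by move=> mB; exact: (uniform_prob2pi (me _ mB)).
rewrite !mE//.
rewrite muleCA lee_pmul2l ?fin_numE//; last by rewrite lte_fin invr_gt0 pi2_gt0.
apply: le_trans (lambda_ext_pull _); apply: le_mu_ext => t [gA]/=.
rewrite in_itv/= => tpi; split => //.
have [s spi sE] := expi_surj (g (expi t)).
exists s => //; split; last by rewrite /= in_itv.
by rewrite /preimage/= sE.
Qed.

End circle_nonsingular.

(** * The disc automorphisms phi_a and their fixed points *)

Definition disc (R : realType) := {a : R[i] | `|a| < 1}.

Section mobius.
Variable R : realType.
Implicit Types (a : disc R) (z w : circle R) (u v : R[i]).

Definition disc_val a : R[i] := val a.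

Lemma disc_norm a : `|disc_val a| < 1. Proof. exact: (valP a). Qed.

Definition mobius a u : R[i] := (disc_val a - u) / (1 - (disc_val a)^* * u).

Lemma mobius_denom_neq0 a u : `|u| <= 1 -> 1 - (disc_val a)^* * u != 0.
Proof.
move=> u1; rewrite subr_eq0; apply/eqP => au; move: (disc_norm a).
have : `|(disc_val a)^* * u| = 1 by rewrite -au normr1.
rewrite normrM normcJ => au1.
move=> a1; have : 1 <= `|disc_val a| by rewrite -au1 ler_piMr.
by move=> /(lt_le_trans a1); rewrite ltxx.
Qed.

Lemma mobius_circle_subproof a z : `|mobius a (val z)| == 1.
Proof.
have z1 : `|val z| = 1 := circle_norm z.
have zz : val z * (val z)^* = 1 by rewrite -sqr_normc z1 expr1n.
rewrite /mobius normrM normrV ?unitfE ?mobius_denom_neq0 ?z1//.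
have -> : 1 - (disc_val a)^* * val z = - (val z * (disc_val a - val z)^*).
  by rewrite rmorphB/= mulrBr zz mulrC opprB.
rewrite normrN normrM z1 mul1r normcJ divff// normr_eq0 subr_eq0.
apply/eqP => az; move: (disc_norm a).
by rewrite az z1 ltxx.
Qed.

Definition mobius_circle a z : circle R :=
  exist (fun u : R[i] => `|u| == 1) (mobius a (val z))
    (mobius_circle_subproof a z).

Lemma measurable_mobius_circle a : measurable_fun setT (mobius_circle a).
Proof.
apply: measurable_circleP; rewrite /= /mobius.
have mN : measurable_fun setT (fun z : circle R => - circle_val z).
  under eq_fun do rewrite -mulN1r.
  by apply: measurable_mulc => //; exact: measurable_circle_val.
apply: measurable_mulc; first by apply: measurable_addc.
apply: measurable_invc.
  by move=> z; rewrite mobius_denom_neq0// circle_norm.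
apply: measurable_addc => //.
under eq_fun do rewrite -mulrN.
by apply: measurable_mulc.
Qed.

Lemma measurable_circle_opp : measurable_fun setT (@circle_opp R).
Proof.
apply: measurable_circleP; rewrite (_ : (fun _ => _) =
  (fun z : circle R => (-1) * circle_val z)).
  by apply: measurable_mulc => //; exact: measurable_circle_val.
by apply/funext => z; rewrite mulN1r.
Qed.

Lemma mobius_circle_expand a : exists2 K : R, 0 <= K & forall z w,
  normc (circle_val z - circle_val w) <=
  K * normc (circle_val (mobius_circle a z) - circle_val (mobius_circle a w)).
Proof.
set b := disc_val a.
have b1 : 0 < 1 - normc b ^+ 2.
  rewrite subr_gt0 -(expr1n _ 2) ltr_pXn2r ?nnegrE ?normc_ge0//.
  by have := disc_norm a; rewrite -[`|_|]/((normc b)%:C) -[1]/(1%:C) ltcR.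
exists (4 / (1 - normc b ^+ 2)); first by rewrite divr_ge0// ltW.
move=> z w; rewrite mulrAC ler_pdivlMr//.
have zw (x : circle R) : normc (circle_val x) = 1.
  by have /(congr1 (@complex.Re R)) := circle_norm x.
have dn (x : circle R) : normc (1 - b^* * circle_val x) <= 2.
  apply: (le_trans (le_normcD _ _)); rewrite normcN normcM zw mulr1.
  have -> : normc (b^*) = normc b by have /(congr1 (@complex.Re R)) := normcJ b.
  rewrite normc1 -[leRHS]/(1 + 1) lerD2l.
  by move: b1; rewrite subr_gt0 expr_lt1 ?normc_ge0// => /ltW.
have d0 (x : circle R) : 1 - b^* * circle_val x != 0.
  by rewrite mobius_denom_neq0 ?circle_norm.
have bb : b * b^* = (normc b ^+ 2)%:C by rewrite -sqr_normc rmorphXn.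
have key : (circle_val z - circle_val w) * (1 - normc b ^+ 2)%:C =
    - (circle_val (mobius_circle a z) - circle_val (mobius_circle a w)) *
    ((1 - b^* * circle_val z) * (1 - b^* * circle_val w)).
  rewrite rmorphB/= -bb /circle_val/= /mobius -/b.
  move: (d0 z) (d0 w); rewrite /circle_val => d0z d0w.
  by field; rewrite d0z d0w.
have := congr1 (@normc R) key; rewrite !normcM normcN.
have -> : normc (1 - normc b ^+ 2)%:C = 1 - normc b ^+ 2.
  by rewrite /= expr0n addr0 sqrtr_sqr gtr0_norm.
move=> ->; rewrite mulrC ler_wpM2r ?normc_ge0//.
by rewrite (_ : 4 = 2 * 2) ?ler_pM ?normc_ge0//; ring.
Qed.

Lemma circle_opp_expand z w :
  normc (circle_val z - circle_val w) <=
  1 * normc (circle_val (circle_opp z) - circle_val (circle_opp w)).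
Proof. by rewrite mul1r /= -opprD normcN. Qed.

Definition omega_val a : R[i] :=
  if disc_val a == 0 then 0
  else ((disc_val a)^*)^-1 * (1 - (Num.sqrt (1 - normc (disc_val a) ^+ 2))%:C).

Lemma omega_subproof a : `|omega_val a| < 1.
Proof.
rewrite /omega_val; case: eqVneq => [_|a0]; first by rewrite normr0 ltr01.
move: (disc_norm a); move: (disc_val a) a0 => b b0.
rewrite -[`|b|]/((normc b)%:C) -[1]/(1%:C) ltcR => b1.
have bgt0 : 0 < normc b.
  rewrite lt_neqAle normc_ge0 andbT eq_sym.
  by apply: contra b0 => /eqP/eq0_normc ->.
set r := normc b in b1 bgt0 *; set s := Num.sqrt _.
have r2 : 0 < 1 - r ^+ 2 by rewrite subr_gt0 expr_lt1// ltW.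
have s0 : 0 < s by rewrite sqrtr_gt0.
have sr : s ^+ 2 = 1 - r ^+ 2 by rewrite sqr_sqrtr// ltW.
have s1E : 1 - s%:C = (1 - s)%:C by rewrite rmorphB.
rewrite s1E normrM normrV ?unitfE ?conjc_eq0// normcJ.
rewrite -[`|b|]/(r%:C) -[`|_%:C|]/((normc _)%:C) -rmorphV ?unitfE ?gt_eqF//=.
rewrite -rmorphM ltcR expr0n addr0 sqrtr_sqr.
rewrite mulrC ltr_pdivrMr// mul1r.
have s1 : s < 1 by nra.
by rewrite gtr0_norm ?subr_gt0//; nra.
Qed.

Definition omega a : disc R :=
  exist (fun u : R[i] => `|u| < 1) (omega_val a) (omega_subproof a).

Lemma mobius_omega a : mobius a (disc_val (omega a)) = disc_val (omega a).
Proof.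
have d0 := mobius_denom_neq0 a (ltW (disc_norm (omega a))).
apply: (mulIf d0); rewrite /mobius mulfVK// /disc_val/= /omega_val -/(disc_val a).
case: eqVneq => [->|a0]; first by rewrite mul0r subr0.
have c0 : (disc_val a)^* != 0 by rewrite conjc_eq0.
have r1 : 0 <= 1 - normc (disc_val a) ^+ 2.
  have := disc_norm a; rewrite -[`|_|]/((normc _)%:C) -[1]/(1%:C) ltcR => r1.
  by rewrite subr_ge0 expr_le1 ?normc_ge0// ltW.
set s := (Num.sqrt _)%:C.
have s2 : s ^+ 2 = 1 - disc_val a * (disc_val a)^*.
  by rewrite -rmorphXn sqr_sqrtr// rmorphB rmorphXn -sqr_normc.
apply: (mulfI c0).
have -> : (disc_val a)^* * (disc_val a - (disc_val a)^*^-1 * (1 - s)) =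
  disc_val a * (disc_val a)^* - (1 - s) by field.
have -> : disc_val a * (disc_val a)^* = 1 - s ^+ 2 by rewrite s2; ring.
by field.
Qed.

Lemma mobius_fixed_uniq a (w : disc R) :
  mobius a (disc_val w) = disc_val w -> w = omega a.
Proof.
have d1 := mobius_denom_neq0 a (ltW (disc_norm w)).
have d2 := mobius_denom_neq0 a (ltW (disc_norm (omega a))).
have := mobius_omega a; move: (omega a) d2 => v d2.
move=> /(congr1 ( *%R^~ (1 - (disc_val a)^* * disc_val v))).
move=> /[swap] /(congr1 ( *%R^~ (1 - (disc_val a)^* * disc_val w))).
rewrite /mobius !mulfVK// => hw hv.
apply/val_inj/eqP; rewrite -subr_eq0 -[val w]/(disc_val w) -[val v]/(disc_val v).
have : (disc_val w - disc_val v) *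
    (2 - (disc_val a)^* * (disc_val w + disc_val v)) = 0.
  transitivity ((disc_val w * (1 - (disc_val a)^* * disc_val w) + disc_val w) -
      (disc_val v * (1 - (disc_val a)^* * disc_val v) + disc_val v)); first by ring.
  by rewrite -hw -hv !subrK subrr.
move=> /eqP; rewrite mulf_eq0 => /orP[//|/eqP/subr0_eq e2].
have : `|(disc_val a)^* * (disc_val w + disc_val v)| < 2.
  rewrite normrM normcJ.
  apply: (@le_lt_trans _ _ `|disc_val w + disc_val v|).
    by rewrite ler_piMl// ltW// disc_norm.
  by rewrite (le_lt_trans (ler_normD _ _))// -[ltRHS]/(1 + 1) ltrD// disc_norm.
by rewrite -e2 normr_nat ltxx.
Qed.

End mobius.

(** * The complex Lebesgue space L^2(mu) *)

Section L2.
Context d (T : measurableType d) (R : realType).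
Variable mu : {measure set T -> \bar R}.

Definition sqint : {pred T -> R[i]} :=
  mem [set f | measurable_fun setT f /\
               (\int[mu]_x (normc (f x) ^+ 2)%:E < +oo)%E].

Lemma measurable_normc_sqrE (f : T -> R[i]) : measurable_fun setT f ->
  measurable_fun setT (fun x => (normc (f x) ^+ 2)%:E).
Proof. by move=> mf; apply/measurable_EFinP; exact: measurable_normc_sqr. Qed.

Lemma sqint_submod_closed : submod_closed sqint.
Proof.
split.
  rewrite inE/=; split; first exact: measurable_cst.
  have -> : (fun x => (normc ((0 : T -> R[i]) x) ^+ 2)%:E) = cst 0%E.
    by apply/funext => x; rewrite [normc _]normc0 expr0n.
  by rewrite integral0.
move=> a f g; rewrite !inE/= => -[mf If] [mg Ig].
have maf : measurable_fun setT (fun x => a * f x).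
  by apply: measurable_mulc => //; exact: measurable_cst.
split; first exact: measurable_addc.
have normc_le (u v : R[i]) :
    normc (a * u + v) ^+ 2 <= 2 * normc a ^+ 2 * normc u ^+ 2 + 2 * normc v ^+ 2.
  have h := le_normcD (a * u) v; rewrite normcM in h.
  have n0 := normc_ge0 (a * u + v); have n1 := normc_ge0 a.
  have n2 := normc_ge0 u; have n3 := normc_ge0 v.
  apply: (@le_trans _ _ ((normc a * normc u + normc v) ^+ 2)).
    by rewrite ler_pXn2r// nnegrE// addr_ge0// mulr_ge0.
  by rewrite -subr_ge0 [leRHS](_ : _ = (normc a * normc u - normc v) ^+ 2) ?sqr_ge0//; ring.
apply: (@le_lt_trans _ _ (\int[mu]_x
    ((2 * normc a ^+ 2)%:E * (normc (f x) ^+ 2)%:E +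
     2%:E * (normc (g x) ^+ 2)%:E))%E).
  apply: ge0_le_integral => //.
  - by move=> x _; rewrite lee_fin sqr_ge0.
  - by apply: measurable_normc_sqrE; exact: measurable_addc.
  - by apply: emeasurable_funD; apply: emeasurable_funM => //;
       exact: measurable_normc_sqrE.
  - by move=> x _; rewrite -!EFinM -EFinD lee_fin; exact: normc_le.
have a0 : 0 <= 2 * normc a ^+ 2 by rewrite mulr_ge0// sqr_ge0.
have sq0 (h : T -> R[i]) x : (0 <= (normc (h x) ^+ 2)%:E)%E.
  by rewrite lee_fin sqr_ge0.
rewrite ge0_integralD//.
- rewrite !ge0_integralZl//; try exact: measurable_normc_sqrE.
  by rewrite lte_add_pinfty// lte_mul_pinfty ?lee_fin.
- by move=> x _; rewrite mule_ge0// lee_fin.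
- by apply: emeasurable_funM => //; exact: measurable_normc_sqrE.
- by move=> x _; rewrite mule_ge0// lee_fin.
- by apply: emeasurable_funM => //; exact: measurable_normc_sqrE.
Qed.

HB.instance Definition _ :=
  GRing.isSubmodClosed.Build _ _ sqint sqint_submod_closed.

Definition L2fun := {f : T -> R[i] | f \in sqint}.
HB.instance Definition _ := SubChoice.on L2fun.
HB.instance Definition _ := [SubChoice_isSubLmodule of L2fun by <:].

Definition L2fun_to_fun (f : L2fun) : T -> R[i] := val f.
Coercion L2fun_to_fun : L2fun >-> Funclass.

Lemma L2fun_sqint (f : L2fun) : measurable_fun setT f /\
  (\int[mu]_x (normc (f x) ^+ 2)%:E < +oo)%E.
Proof. by have := valP f; rewrite inE. Qed.

Definition L2_ae_eq (f g : L2fun) := `[< {ae mu, forall x, f x = g x} >].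

Let L2_ae_eq_refl : reflexive L2_ae_eq.
Proof. by move=> f; apply/asboolP; apply/nearW. Qed.

Let L2_ae_eq_sym : symmetric L2_ae_eq.
Proof.
move=> f g; apply/asboolP/asboolP; apply: filterS => x; exact: esym.
Qed.

Let L2_ae_eq_trans : transitive L2_ae_eq.
Proof.
move=> g f h /asboolP fg /asboolP gh; apply/asboolP.
by apply: filterS2 fg gh => x -> ->.
Qed.

Canonical L2_ae_eq_canonical :=
  EquivRel L2_ae_eq L2_ae_eq_refl L2_ae_eq_sym L2_ae_eq_trans.

Local Open Scope quotient_scope.

Definition L2 : Type := {eq_quot L2_ae_eq}.
HB.instance Definition _ := Choice.on L2.
HB.instance Definition _ := EqQuotient.on L2.

(* An element of L2 coerces to a chosen representative, so it may only be used
   in statements that are invariant under a.e. equality. *)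
Definition L2_to_fun (u : L2) : T -> R[i] := repr u.
Coercion L2_to_fun : L2 >-> Funclass.

Lemma L2_piP (f g : L2fun) :
  (\pi_L2 f = \pi_L2 g) <-> {ae mu, forall x, f x = g x}.
Proof. by split => [/eqquotP/asboolP|h]; [|apply/eqquotP/asboolP]. Qed.

Lemma L2_repr (f : L2fun) : {ae mu, forall x, L2_to_fun (\pi_L2 f) x = f x}.
Proof. by apply/L2_piP; rewrite reprK. Qed.

Definition L2_zero : L2 := \pi_L2 (0 : L2fun).
Definition L2_add (u v : L2) : L2 := \pi_L2 (repr u + repr v).
Definition L2_opp (u : L2) : L2 := \pi_L2 (- repr u).
Definition L2_scale (c : R[i]) (u : L2) : L2 := \pi_L2 (c *: repr u).

Lemma L2_addE (f g : L2fun) : L2_add (\pi_L2 f) (\pi_L2 g) = \pi_L2 (f + g).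
Proof.
apply/L2_piP; apply: filterS2 (L2_repr f) (L2_repr g) => x.
by rewrite /L2_to_fun /L2fun_to_fun /= !fctE => -> ->.
Qed.

Lemma L2_oppE (f : L2fun) : L2_opp (\pi_L2 f) = \pi_L2 (- f).
Proof.
apply/L2_piP; apply: filterS (L2_repr f) => x.
by rewrite /L2_to_fun /L2fun_to_fun /= !fctE => ->.
Qed.

Lemma L2_scaleE c (f : L2fun) : L2_scale c (\pi_L2 f) = \pi_L2 (c *: f).
Proof.
apply/L2_piP; apply: filterS (L2_repr f) => x.
by rewrite /L2_to_fun /L2fun_to_fun /= !fctE => ->.
Qed.

Let L2_addA : associative L2_add.
Proof.
move=> u v w; rewrite -(reprK u) -(reprK v) -(reprK w).
by rewrite (L2_addE (repr v)) (L2_addE (repr u) (repr v)) !L2_addE addrA.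
Qed.

Let L2_addC : commutative L2_add.
Proof. by move=> u v; rewrite -(reprK u) -(reprK v) !L2_addE addrC. Qed.

Let L2_add0 : left_id L2_zero L2_add.
Proof. by move=> u; rewrite -(reprK u) L2_addE add0r. Qed.

Let L2_addN : left_inverse L2_zero L2_opp L2_add.
Proof. by move=> u; rewrite -(reprK u) L2_oppE L2_addE addNr. Qed.

HB.instance Definition _ :=
  GRing.isZmodule.Build L2 L2_addA L2_addC L2_add0 L2_addN.

Lemma L2_piD (f g : L2fun) : \pi_L2 (f + g) = \pi_L2 f + \pi_L2 g.
Proof. exact/esym/L2_addE. Qed.

Let L2_scaleA a b (u : L2) : L2_scale a (L2_scale b u) = L2_scale (a * b) u.
Proof. by rewrite -(reprK u) (L2_scaleE b) !L2_scaleE scalerA. Qed.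

Let L2_scale1 : left_id 1 L2_scale.
Proof. by move=> u; rewrite -(reprK u) L2_scaleE scale1r. Qed.

Let L2_scaleDr : right_distributive L2_scale +%R.
Proof.
move=> c u v; rewrite -(reprK u) -(reprK v).
by rewrite -L2_piD !L2_scaleE -L2_piD scalerDr.
Qed.

Let L2_scaleDl (u : L2) : {morph L2_scale^~ u : a b / a + b >-> a + b}.
Proof.
by move=> a b; rewrite -(reprK u) !L2_scaleE -!L2_piD scalerDl.
Qed.

HB.instance Definition _ := GRing.Zmodule_isLmodule.Build R[i] L2
  L2_scaleA L2_scale1 L2_scaleDr L2_scaleDl.

Lemma L2_piZ c (f : L2fun) : \pi_L2 (c *: f) = c *: \pi_L2 f.
Proof. exact/esym/L2_scaleE. Qed.

End L2.

(** * Composition operators on L^2 of the circle *)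

Section nonsingular.
Variable R : realType.
Variables (g : circle R -> circle R) (K : R).
Hypothesis K0 : 0 <= K.
Hypothesis mg : measurable_fun setT g.
Hypothesis gK : forall z w : circle R,
  normc (circle_val z - circle_val w) <=
  K * normc (circle_val (g z) - circle_val (g w)).

Local Notation sigma := (circle_measure R).

Lemma ae_comp (P : circle R -> Prop) :
  {ae sigma, forall z, P z} -> {ae sigma, forall z, P (g z)}.
Proof.
have [M _ gM] := circle_measure_preimage K0 mg gK.
move=> [A [mA A0 PA]]; exists (g @^-1` A); split.
- by rewrite -[X in measurable X]setTI; exact: mg.
- apply/eqP; rewrite eq_le measure_ge0 andbT.
  by rewrite (le_trans (gM _ mA))// A0 mule0.
- by move=> z /= nP; apply: PA.
Qed.

Lemma sqint_comp (f : L2fun sigma) : (f \o g : _ -> _) \in sqint sigma.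
Proof.
have [M M0 gM] := circle_measure_preimage K0 mg gK.
have [mf If] := L2fun_sqint f.
rewrite inE; split; first exact: measurableT_comp.
pose h := fun z => (normc (f z) ^+ 2)%:E.
have h0 z : (0 <= h z)%E by rewrite lee_fin sqr_ge0.
have mh : measurable_fun setT h by exact: measurable_normc_sqrE.
pose gm : {mfun circle R >-> circle R} := HB.pack g (isMeasurableFun.Build _ _ _ _ _ mg).
have -> : (\int[sigma]_x (normc ((f \o g) x) ^+ 2)%:E =
    \int[distribution sigma gm]_x h x)%E.
  by rewrite ge0_integral_distribution.
apply: (@le_lt_trans _ _ (\int[mscale (NngNum M0) sigma]_x h x)%E).
  by apply: ge0_le_measure_integral => // S mS; exact: gM.
by rewrite ge0_integral_mscale// lte_mul_pinfty.
Qed.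

End nonsingular.

Notation L2_circle R := (L2 (circle_measure R)).
Notation L2fun_circle R := (L2fun (circle_measure R)).

Section composition_operator.
Variable R : realType.
Implicit Types (a : disc R) (f : L2fun_circle R) (u : L2_circle R).
Local Open Scope quotient_scope.

Lemma ae_mobius a (P : circle R -> Prop) :
  {ae circle_measure R, forall z, P z} ->
  {ae circle_measure R, forall z, P (mobius_circle a z)}.
Proof.
have [K K0 aK] := mobius_circle_expand a.
exact: (ae_comp K0 (measurable_mobius_circle a) aK).
Qed.

Lemma ae_circle_opp (P : circle R -> Prop) :
  {ae circle_measure R, forall z, P z} ->
  {ae circle_measure R, forall z, P (circle_opp z)}.
Proof. exact: (ae_comp ler01 (@measurable_circle_opp R) (@circle_opp_expand R)). Qed.

Lemma mobius_sqint a f :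
  (f \o mobius_circle a : _ -> _) \in sqint (circle_measure R).
Proof.
have [K K0 aK] := mobius_circle_expand a.
exact: (sqint_comp K0 (measurable_mobius_circle a) aK).
Qed.

Definition L2fun_comp a f : L2fun_circle R :=
  exist (fun h => h \in sqint (circle_measure R))
    (f \o mobius_circle a) (mobius_sqint a f).

(* The definition goes through a representative; comp_op_pi shows that the
   choice is irrelevant. *)
Definition comp_op a u : L2_circle R :=
  \pi_(L2_circle R) (L2fun_comp a (repr u)).

Lemma comp_op_pi a f :
  comp_op a (\pi_(L2_circle R) f) = \pi_(L2_circle R) (L2fun_comp a f).
Proof. by apply/L2_piP; exact: (ae_mobius a (L2_repr f)). Qed.

Lemma comp_opE a u :
  {ae circle_measure R, forall z, comp_op a u z = u (mobius_circle a z)}.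
Proof. exact: L2_repr. Qed.

Lemma comp_op_is_linear a : linear (comp_op a).
Proof.
move=> c u v; rewrite -(reprK u) -(reprK v) -L2_piZ -L2_piD !comp_op_pi.
by rewrite -L2_piZ -L2_piD; congr (\pi_(L2_circle R) _); exact: val_inj.
Qed.

HB.instance Definition _ a :=
  GRing.isLinear.Build R[i] (L2_circle R) (L2_circle R) *:%R (comp_op a)
    (comp_op_is_linear a).

End composition_operator.

Section parity.
Variable R : realType.

(* Independent of the representative by even_L2_pi and odd_L2_pi below. *)
Definition even_L2 : set (L2_circle R) :=
  [set u | {ae circle_measure R, forall z, u (circle_opp z) = u z}].

Definition odd_L2 : set (L2_circle R) :=
  [set u | {ae circle_measure R, forall z, u (circle_opp z) = - u z}].

Local Open Scope quotient_scope.

Lemma even_L2_pi (f : L2fun_circle R) : even_L2 (\pi_(L2_circle R) f) <->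
  {ae circle_measure R, forall z, f (circle_opp z) = f z}.
Proof.
have ff := L2_repr f; have fN := ae_circle_opp ff.
split; apply: filterS3 ff fN => z; first by move=> -> -> ->.
by move=> -> -> ->.
Qed.

Lemma odd_L2_pi (f : L2fun_circle R) : odd_L2 (\pi_(L2_circle R) f) <->
  {ae circle_measure R, forall z, f (circle_opp z) = - f z}.
Proof.
have ff := L2_repr f; have fN := ae_circle_opp ff.
split; apply: filterS3 ff fN => z; first by move=> -> -> ->.
by move=> -> -> ->.
Qed.

End parity.

Arguments even_L2 : clear implicits.
Arguments odd_L2 : clear implicits.

Definition nullspace (K : pzRingType) (V W : lmodType K) (A : {linear V -> W}) :
  set V := [set v | A v = 0].

(* Main.v *)
Require Import Defs.
From mathcomp Require Import all_boot all_order all_algebra.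
From mathcomp Require Import ring.
From mathcomp Require Import complex.
From mathcomp Require Import all_classical all_reals all_analysis.

Import Order.TTheory GRing.Theory Num.Theory.

Local Open Scope classical_set_scope.
Local Open Scope ring_scope.
Local Open Scope complex_scope.

(** Write [w] for the fixed point [omega a].  The automorphism
    phi_w o phi_a o phi_w of the disc fixes 0 and is an involution other than
    the identity, so it is [z |-> - z]; since phi_w is its own inverse, this
    reads phi_a o phi_w = phi_w o (-1) on the circle ([mobius_circle_omega]).
    Hence, up to the change of variable phi_w, which respects null sets in both
    directions, comparing [f (phi_a z)] with [f z] is the same as comparing
    [f (phi_w (- z))] with [f (phi_w z)] ([ae_mobius_omega]): the eigenvectors
    of [comp_op a] for the eigenvalues 1 and -1 are the [f] such that
    [f o phi_w] is even, respectively odd.  The descriptions as images only use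
    that [comp_op w] is an involution ([comp_opK]). *)

Section FractionalLinear.
Variable F : fieldType.
Implicit Types b c v w : F.

(* [c] and [wc] play the conjugates of [b] and [w]: as independent variables
   they leave identities between rational functions. *)
Local Notation mob b c v := ((b - v) / (1 - c * v)).

Lemma mobK b c v :
  1 - c * v != 0 -> 1 - c * mob b c v != 0 -> mob b c (mob b c v) = v.
Proof. by move=> d0 d1; apply: (mulIf d1); rewrite mulfVK//; field. Qed.

(** The relations between [b], [c] and [w], [wc] are those between a disc
    automorphism and its fixed point; substituting them turns the numerator and
    denominator of the left-hand side into w + v and 1 + wc v, up to a common
    factor. *)
Lemma mob_conj w wc b c v : 1 + w * wc != 0 ->
  b * (1 + w * wc) = 2 * w -> c * (1 + w * wc) = 2 * wc ->
  1 - wc * v != 0 -> 1 - wc * - v != 0 -> 1 - c * mob w wc v != 0 ->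
  mob b c (mob w wc v) = mob w wc (- v).
Proof.
move=> r0 bE cE d0 d2 d1; apply: (mulIf d1); rewrite mulfVK//.
have -> : b = 2 * w / (1 + w * wc) by rewrite -bE mulfK.
have -> : c = 2 * wc / (1 + w * wc) by rewrite -cE mulfK.
by field; rewrite d0 r0.
Qed.

End FractionalLinear.

Section MobiusConjugation.
Variable R : realType.
Implicit Types (a : disc R) (z : circle R).

Lemma disc_norm_sqr_lt1 a : disc_val a * (disc_val a)^* < 1.
Proof. by rewrite -sqr_normc expr_lt1 ?disc_norm. Qed.

Lemma mobius_circleK a : involutive (mobius_circle a).
Proof.
move=> z; apply: val_inj; apply: mobK; apply: mobius_denom_neq0.
  by rewrite (circle_norm z).
by rewrite (circle_norm (mobius_circle a z)).
Qed.

(** Eliminating the conjugate of [a] between the fixed-point equation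
    a + conj(a) w^2 = 2 w and its conjugate gives
    a (1 - |w|^4) = 2 w (1 - |w|^2), and |w| < 1. *)
Lemma omega_double a (w := disc_val (omega a)) :
  disc_val a * (1 + w * w^*) = 2 * w.
Proof.
have d0 := mobius_denom_neq0 a (ltW (disc_norm (omega a))).
have := mobius_omega a; rewrite -/w in d0 *.
move=> /(congr1 ( *%R^~ (1 - (disc_val a)^* * w))).
rewrite /mobius mulfVK// => fixw.
have fixwC : (disc_val a)^* - w^* = w^* * (1 - disc_val a * w^*).
  by have := congr1 (@conjc R) fixw; rewrite !(rmorphB, rmorphM, rmorph1)/= conjcK.
have r1 : 1 - w * w^* != 0.
  by rewrite subr_eq0 eq_sym lt_eqF// disc_norm_sqr_lt1.
apply: (mulIf r1); apply/eqP; rewrite -subr_eq0; apply/eqP.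
transitivity ((disc_val a - w - w * (1 - (disc_val a)^* * w)) -
  w ^+ 2 * ((disc_val a)^* - w^* - w^* * (1 - disc_val a * w^*))); first by ring.
by rewrite fixw fixwC !subrr mulr0 subr0.
Qed.

(** Conjugation by phi_w carries phi_a to the half-turn about the origin. *)
Lemma mobius_circle_omega a z :
  mobius_circle a (mobius_circle (omega a) z) =
  mobius_circle (omega a) (circle_opp z).
Proof.
have aE := omega_double a.
have aCE : (disc_val a)^* * (1 + disc_val (omega a) * (disc_val (omega a))^*) =
    2 * (disc_val (omega a))^*.
  have := congr1 (@conjc R) aE.
  rewrite !(rmorphM, rmorphD, rmorph1, rmorph_nat)/= conjcK => <-.
  by rewrite [_^* * disc_val _]mulrC.
have r0 : 1 + disc_val (omega a) * (disc_val (omega a))^* != 0.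
  by rewrite gt_eqF// ltr_wpDr// mul_conjC_ge0.
apply: val_inj; apply: mob_conj => //; apply: mobius_denom_neq0.
- by rewrite (circle_norm z).
- by rewrite (circle_norm (circle_opp z)).
- by rewrite (circle_norm (mobius_circle (omega a) z)).
Qed.

(** The two conditions are exchanged by the substitution phi_w, which maps null
    sets to null sets and is its own inverse. *)
Lemma ae_mobius_omega a (P : circle R -> circle R -> Prop) :
  {ae circle_measure R, forall z, P (mobius_circle a z) z} <->
  {ae circle_measure R, forall z,
     P (mobius_circle (omega a) (circle_opp z)) (mobius_circle (omega a) z)}.
Proof.
split=> /(ae_mobius (omega a)); apply: filterS => z.
  by rewrite mobius_circle_omega.
by rewrite -mobius_circle_omega mobius_circleK.
Qed.

End MobiusConjugation.

Section CompositionOperator.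
Variable R : realType.
Implicit Types (a : disc R) (f : L2_circle R).
Local Open Scope quotient_scope.

Lemma L2_aeP f g : f = g <-> {ae circle_measure R, forall z, f z = g z}.
Proof. by rewrite -{1}(reprK f) -{1}(reprK g); exact: L2_piP. Qed.

Lemma comp_opK a : involutive (comp_op a).
Proof.
move=> f; apply/L2_aeP.
apply: filterS2 (comp_opE a (comp_op a f)) (ae_mobius a (comp_opE a f)) => z.
by move=> -> ->; rewrite mobius_circleK.
Qed.

Lemma comp_op_preimageE a (A : set (L2_circle R)) :
  [set f | A (comp_op a f)] = comp_op a @` A.
Proof.
apply/seteqP; split=> [f Af|_ [f Af <-]] /=; last by rewrite comp_opK.
by exists (comp_op a f); rewrite ?comp_opK.
Qed.

Lemma comp_op_eqP a f : comp_op a f = f <->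
  {ae circle_measure R, forall z, f (mobius_circle a z) = f z}.
Proof.
rewrite L2_aeP; split; apply: filterS2 (comp_opE a f) => z; first by move=> <-.
by move=> ->.
Qed.

Lemma comp_op_eqNP a f : comp_op a f = - f <->
  {ae circle_measure R, forall z, f (mobius_circle a z) = - f z}.
Proof.
have fN : {ae circle_measure R, forall z, L2_to_fun (- f) z = - f z}.
  exact: (L2_repr (- repr f)).
rewrite L2_aeP; split; apply: filterS3 (comp_opE a f) fN => z.
  by move=> <- <-.
by move=> -> ->.
Qed.

Lemma even_comp_omegaP a f :
  even_L2 R (comp_op (omega a) f) <-> comp_op a f = f.
Proof.
rewrite comp_op_eqP (ae_mobius_omega R a (fun x y => f x = f y)).
exact: even_L2_pi.
Qed.

Lemma odd_comp_omegaP a f :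
  odd_L2 R (comp_op (omega a) f) <-> comp_op a f = - f.
Proof.
rewrite comp_op_eqNP (ae_mobius_omega R a (fun x y => f x = - f y)).
exact: odd_L2_pi.
Qed.

End CompositionOperator.

Theorem theorem3p2 (R : realType) (a : disc R) :
  (nullspace (comp_op a \- idfun)
     = [set f : L2_circle R | even_L2 R (comp_op (omega a) f)] /\
   [set f : L2_circle R | even_L2 R (comp_op (omega a) f)]
     = comp_op (omega a) @` even_L2 R) /\
  (nullspace (comp_op a \+ idfun)
     = [set g : L2_circle R | odd_L2 R (comp_op (omega a) g)] /\
   [set g : L2_circle R | odd_L2 R (comp_op (omega a) g)]
     = comp_op (omega a) @` odd_L2 R).
Proof.
split; split; try exact: comp_op_preimageE.
  apply/seteqP; split=> f /=; rewrite /nullspace /=.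
    by move=> /subr0_eq /even_comp_omegaP.
  by move=> /even_comp_omegaP ->; rewrite subrr.
apply/seteqP; split=> g /=; rewrite /nullspace /=.
  by move=> /eqP; rewrite addr_eq0 => /eqP /odd_comp_omegaP.
by move=> /odd_comp_omegaP ->; rewrite addNr.
Qed.
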